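(* Let $A$ be an alphabet and let $F\subseteq A^*$ be a set of words each of length at least $2$ which is reduced (no word of $F$ is a subword of another word of $F$). For $v\in A^*$ let $M(v)$ be the coefficient of $v$ in $\bigl(\sum_{w\in A_F}w\bigr)^{-1}$, where $A_F$ is the set of words with no subword in $F$, and call a word $v$ of length greater than $1$ salient if $M(v)\neq 0$. Let $w=\alpha_1\alpha_2\cdots\alpha_n$ be a cluster word. If $w\in F$, then $w$ is salient and $M(w)=1$. Otherwise, let $j$ be the index such that $\alpha_j\alpha_{j+1}\cdots\alpha_n\in F$ (the last occurrence of a word of $F$ in $w$). Then $w$ is salient if and only if there is exactly one salient initial subword $w'=\alpha_1\alpha_2\cdots\alpha_m$ of $w$ with $j\le m<n$, and in this case $M(w)=-M(w')$.
   Context: $A^*$ is the free monoid of finite words over $A$ with empty word $1$; the inverse is taken in the ring $\mathbb{Z}\langle\langle A^*\rangle\rangle$ of formal integer combinations of words with multiplication extending concatenation. $u$ is a subword of $v$ if $v=puq$ for words $p,q$. For integers $a,b$, $[a,b)=\{i\in\mathbb{Z}:a\le i<b\}$. For $w=\alpha_1\cdots\alpha_n$ and $1\le i<k\le n$, the subword $\alpha_i\cdots\alpha_k$ is said to occur at the interval $[i,k)$. A marked word is a pair $(w,I)$ with $w\in A^*$ and $I$ a set of intervals $[i,k)$, $1\le i<k\le|w|$, such that $\alpha_i\cdots\alpha_k\in F$. Concatenation: $(u,I)(v,J)=(uv,I\cup(J+|u|))$ with $J+|u|=\{[i+|u|,k+|u|):[i,k)\in J\}$. A marked word $(u,I)$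 is a cluster if $|u|\ge2$ and it is not a concatenation of two marked words with nonempty underlying words; a cluster word is the underlying word of some cluster. *)

(* Defs.v *)
From HB Require Import structures.
From mathcomp Require Import all_boot all_order all_algebra.
From mathcomp Require Import boolp classical_sets.

Set Implicit Arguments.
Unset Strict Implicit.
Unset Printing Implicit Defensive.

Import GRing.Theory.
Local Open Scope ring_scope.
Local Open Scope classical_set_scope.

(* The ring Z<<A^*>>: a formal integer combination of words is the function
   giving the coefficient of each word.  It is wrapped in a record so that it
   does not inherit the pointwise product of functions. *)
Record wseries (A : Type) := WSeries { wcoef : seq A -> int }.

Section WSeriesRing.
Variable A : Type.
Implicit Types (f g h : wseries A) (w : seq A).

Lemma wseriesP f g : (forall w, wcoef f w = wcoef g w) -> f = g.
Proof. by case: f g => [f] [g] /= fg; congr WSeries; apply: funext. Qed.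

HB.instance Definition _ := gen_eqMixin (wseries A).
HB.instance Definition _ := gen_choiceMixin (wseries A).

Definition ws0 : wseries A := WSeries (fun=> 0).
Definition wsopp f : wseries A := WSeries (fun w => - wcoef f w).
Definition wsadd f g : wseries A := WSeries (fun w => wcoef f w + wcoef g w).

Fact wsaddA : associative wsadd.
Proof. by move=> f g h; apply: wseriesP => w /=; rewrite addrA. Qed.
Fact wsaddC : commutative wsadd.
Proof. by move=> f g; apply: wseriesP => w /=; rewrite addrC. Qed.
Fact wsadd0 : left_id ws0 wsadd.
Proof. by move=> f; apply: wseriesP => w /=; rewrite add0r. Qed.
Fact wsaddN : left_inverse ws0 wsopp wsadd.
Proof. by move=> f; apply: wseriesP => w /=; rewrite addNr. Qed.

HB.instance Definition _ :=
  GRing.isZmodule.Build (wseries A) wsaddA wsaddC wsadd0 wsaddN.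

Definition ws1 : wseries A := WSeries (fun w => (nilp w)%:R).

(* The coefficient of w in f * g is the sum of f(u) g(v) over the
   factorizations w = uv. *)
Definition wsmul f g : wseries A :=
  WSeries (fun w =>
    \sum_(i < (size w).+1) wcoef f (take i w) * wcoef g (drop i w)).

Definition wsshift (a : A) f : wseries A := WSeries (fun w => wcoef f (a :: w)).
Definition wsscale (c : int) f : wseries A := WSeries (fun w => c * wcoef f w).

Lemma wcoef_wsmul_nil f g : wcoef (wsmul f g) [::] = wcoef f [::] * wcoef g [::].
Proof. by rewrite /= big_ord_recl big_ord0 addr0. Qed.

Lemma wcoef_wsmul_cons f g a w : wcoef (wsmul f g) (a :: w) =
  wcoef f [::] * wcoef g (a :: w) + wcoef (wsmul (wsshift a f) g) w.
Proof. by rewrite /= big_ord_recl. Qed.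

Fact wsmulDl : left_distributive wsmul wsadd.
Proof.
move=> f g h; apply: wseriesP => w /=.
by rewrite -big_split; apply: eq_bigr => i _; rewrite mulrDl.
Qed.
Fact wsmulDr : right_distributive wsmul wsadd.
Proof.
move=> f g h; apply: wseriesP => w /=.
by rewrite -big_split; apply: eq_bigr => i _; rewrite mulrDr.
Qed.

Lemma wsmulZl c f g : wsmul (wsscale c f) g = wsscale c (wsmul f g).
Proof.
apply: wseriesP => w /=.
by rewrite big_distrr; apply: eq_bigr => i _; rewrite /= mulrA.
Qed.

Lemma wsshift_mul a f g : wsshift a (wsmul f g) =
  wsadd (wsscale (wcoef f [::]) (wsshift a g)) (wsmul (wsshift a f) g).
Proof. by apply: wseriesP => w; apply: wcoef_wsmul_cons. Qed.

Fact wsmulA : associative wsmul.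
Proof.
move=> f g h; apply: wseriesP => w.
elim: w f => [|a w IHw] f; first by rewrite !wcoef_wsmul_nil mulrA.
rewrite !(wcoef_wsmul_cons f) (wcoef_wsmul_cons (wsmul f g)) wsshift_mul.
rewrite wsmulDl wsmulZl wcoef_wsmul_nil wcoef_wsmul_cons IHw.
by rewrite mulrDr mulrA addrA.
Qed.

Fact wsmul1l : left_id ws1 wsmul.
Proof.
move=> f; apply: wseriesP => -[|a w]; first by rewrite wcoef_wsmul_nil mul1r.
rewrite wcoef_wsmul_cons mul1r /= big1 ?addr0 // => i _; exact: mul0r.
Qed.

Fact wsmul1r : right_id ws1 wsmul.
Proof.
move=> f; apply: wseriesP => w.
elim: w f => [|a w IHw] f; first by rewrite wcoef_wsmul_nil mulr1.
by rewrite wcoef_wsmul_cons IHw /= mulr0 add0r.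
Qed.

Fact ws1_neq0 : ws1 != 0.
Proof. by apply/eqP => /(congr1 (fun f => wcoef f [::])). Qed.

HB.instance Definition _ := GRing.Zmodule_isNzRing.Build (wseries A)
  wsmulA wsmul1l wsmul1r wsmulDl wsmulDr ws1_neq0.

Definition wsunit : pred (wseries A) :=
  fun f => `[< exists g, g * f = 1 /\ f * g = 1 >].

Definition wsinv f : wseries A :=
  match pselect (exists g, g * f = 1 /\ f * g = 1) with
  | left fu => projT1 (cid fu)
  | right _ => f
  end.

Fact wsmulVr : {in wsunit, left_inverse 1 wsinv *%R}.
Proof.
move=> f /asboolP fu; rewrite /wsinv; case: pselect => // fu'.
by case: (cid fu') => g [].
Qed.
Fact wsmulrV : {in wsunit, right_inverse 1 wsinv *%R}.
Proof.
move=> f /asboolP fu; rewrite /wsinv; case: pselect => // fu'.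
by case: (cid fu') => g [].
Qed.
Fact wsunitP f g : g * f = 1 /\ f * g = 1 -> wsunit f.
Proof. by move=> gf; apply/asboolP; exists g. Qed.
Fact wsinv_out : {in [predC wsunit], wsinv =1 id}.
Proof.
move=> f /negP fNu; rewrite /wsinv; case: pselect => // fu.
by case: fNu; apply/asboolP.
Qed.

HB.instance Definition _ := GRing.NzRing_hasMulInverse.Build (wseries A)
  wsmulVr wsmulrV wsunitP wsinv_out.

Lemma wcoefD f g w : wcoef (f + g) w = wcoef f w + wcoef g w. Proof. by []. Qed.
Lemma wcoefN f w : wcoef (- f) w = - wcoef f w. Proof. by []. Qed.
Lemma wcoef1 w : wcoef (1 : wseries A) w = (nilp w)%:R. Proof. by []. Qed.
Lemma wcoefM f g w : wcoef (f * g) w =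
  \sum_(i < (size w).+1) wcoef f (take i w) * wcoef g (drop i w).
Proof. by []. Qed.
Lemma wcoef_sum n (F : 'I_n -> wseries A) w :
  wcoef (\sum_(i < n) F i) w = \sum_(i < n) wcoef (F i) w.
Proof. by elim/big_ind2: _ => // f x g y <- <-. Qed.

Lemma wcoefX_small f n w :
  wcoef f [::] = 0 -> (size w < n)%N -> wcoef (f ^+ n) w = 0.
Proof.
move=> f0; elim: n w => // n IHn w wn; rewrite exprS wcoefM big1 // => -[i /= iw] _.
case: i iw => [|i] iw; first by rewrite take0 f0 mul0r.
case: w wn iw => // a w wn iw; rewrite [X in _ * X]IHn ?mulr0 //=.
by rewrite size_drop (leq_ltn_trans (leq_subr _ _)).
Qed.

Lemma wseries_unit f : wcoef f [::] = 1 -> f \is a GRing.unit.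
Proof.
move=> f1; pose h := 1 - f.
have h0 : wcoef h [::] = 0 by rewrite wcoefD wcoefN f1 wcoef1 subrr.
pose s N := \sum_(i < N) h ^+ i.
have fs N : f * s N = 1 - h ^+ N.
  by rewrite -[RHS]opprB subrX1 -mulNr opprB opprB addrC subrK.
have sf N : s N * f = 1 - h ^+ N.
  rewrite -fs; apply: commr_sym; apply: commr_sum => i _; apply: commrX.
  by apply: commrB; [exact: commr1|].
pose g : wseries A := WSeries (fun w => wcoef (s (size w).+1) w).
have gE N w : (size w < N)%N -> wcoef g w = wcoef (s N) w.
  move=> wN; rewrite /= !wcoef_sum -(subnKC wN) big_split_ord /=.
  by rewrite [X in _ + X]big1 ?addr0 // => i _; rewrite wcoefX_small //= addSn ltnS leq_addr.
apply/unitrP; exists g; split; apply: wseriesP => w.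
  have -> : wcoef (g * f) w = wcoef (s (size w).+1 * f) w.
    rewrite !wcoefM; apply: eq_bigr => i _; rewrite (gE (size w).+1) // ltnS.
    by rewrite size_take_min geq_minr.
  by rewrite sf wcoefD wcoefN wcoefX_small // subr0.
have -> : wcoef (f * g) w = wcoef (f * s (size w).+1) w.
  rewrite !wcoefM; apply: eq_bigr => i _; rewrite (gE (size w).+1) // ltnS.
  by rewrite size_drop leq_subr.
by rewrite fs wcoefD wcoefN wcoefX_small // subr0.
Qed.

End WSeriesRing.

Section Clusters.
Variable A : Type.
Implicit Types (F : set (seq A)) (u v w : seq A).

Definition subword u v : Prop := exists p q, v = p ++ u ++ q.

Definition reduced F : Prop :=
  forall u v, F u -> F v -> subword u v -> u = v.

Definition avoiding F : set (seq A) :=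
  [set w | forall u, F u -> ~ subword u w].

Definition avoiding_series F : wseries A :=
  WSeries (fun w => (`[< avoiding F w >])%:R).

Definition Mcoef F v : int := wcoef (avoiding_series F)^-1 v.

Lemma avoiding_series_unit F :
  (forall u, F u -> (2 <= size u)%N) -> avoiding_series F \is a GRing.unit.
Proof.
move=> F2; apply: wseries_unit => /=; rewrite asboolT // => u /F2 u2 [p [q]].
by move/(congr1 size); rewrite !size_cat /=; case: (size u) u2 => // n _; rewrite addnC.
Qed.

Definition salient F v : Prop := (1 < size v)%N /\ Mcoef F v <> 0.

(* alpha_i ... alpha_k, with letters numbered from 1 and both ends included. *)
Definition factor w (i k : nat) : seq A := drop i.-1 (take k w).

(* The pair (i, k) stands for the interval [i, k); as only i < k occurs, the
   interval determines the pair. *)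
Definition marked F (x : seq A * set (nat * nat)) : Prop :=
  forall i k, x.2 (i, k) ->
    [/\ (1 <= i)%N, (i < k)%N, (k <= size x.1)%N & F (factor x.1 i k)].

Definition mconcat (x y : seq A * set (nat * nat)) :
    seq A * set (nat * nat) :=
  (x.1 ++ y.1,
   x.2 `|` [set (p.1 + size x.1, p.2 + size x.1)%N | p in y.2]).

Definition cluster F (x : seq A * set (nat * nat)) : Prop :=
  [/\ marked F x, (2 <= size x.1)%N &
      ~ exists y z, [/\ marked F y, marked F z, (0 < size y.1)%N,
                        (0 < size z.1)%N & x = mconcat y z]].

Definition cluster_word F w : Prop := exists I, cluster F (w, I).

End Clusters.

(* Main.v *)
Require Import Defs.
From HB Require Import structures.
From mathcomp Require Import all_boot all_order all_algebra.
From mathcomp Require Import boolp classical_sets.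
From mathcomp Require Import zify.

(** Let [R k] be the sum of the [M (take i w)] over [i < k], and let
    [e m] be the least [i] such that [drop i (take m w)] avoids [F].  Comparing
    coefficients of [take m w] in [S^-1 * S = 1], with [S] the series of the
    words avoiding [F], gives [R m.+1 = R (e m)] for
    [0 < m <= size w].  As [R 0 = 0] and [R 1 = 1], all the partial sums are
    [0] or [1], and [M (take m w)] is nonzero exactly where [R] changes value.
    Since [e] is nondecreasing, three changes of [R] inside a window
    [[e m, m]] are carried by [t |-> e t.-1] to changes of [R] further left,
    which yields a smaller window with three changes; hence no window has three
    changes.  When [w] has a suffix in [F] starting at [j], reducedness gives
    [e (size w) = j], so [M w = R j - R (size w)] is nonzero iff [R] changes
    exactly once between [j] and [size w]. *)

Set Implicit Arguments.
Unset Strict Implicit.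
Unset Printing Implicit Defensive.

Import GRing.Theory.
Local Open Scope ring_scope.
Local Open Scope classical_set_scope.

(** * Changes of value of a boolean sequence along a monotone recursion *)

Section Changes.
Variable r : nat -> bool.

Lemma exists_change a b : (a <= b)%N -> r a != r b ->
  exists m, [/\ (a <= m < b)%N, r m = r a & r m.+1 = r b].
Proof.
move=> leab; rewrite -(subnKC leab); elim: (b - a)%N => [|d IHd].
  by rewrite addn0 eqxx.
have [rad|rad] := eqVneq (r a) (r (a + d)%N).
  by rewrite addnS => _; exists (a + d)%N; split => //; lia.
have [m [am rm rm1]] := IHd rad; move=> radS.
exists m; split => //; first by lia.
by move: rad radS; rewrite rm1; case: (r a) (r (a + d)%N) (r (a + d.+1)%N) => -[] [].
Qed.

Variables (n : nat) (e : nat -> nat).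
Hypothesis e_homo : {homo e : m p / (m <= p)%N}.
Hypothesis r_e : forall m, (0 < m <= n)%N -> r m.+1 = r (e m).

(** Descent on [m]: the points [e t.-1] for [t1], [t2], [t3] keep the values of [r], hence stay
    distinct and ordered, and lie at or below [t0]. *)
Lemma window_three_changes m t0 t1 t2 t3 : (0 < m <= n)%N ->
  (e m <= t0)%N -> (t0 < t1)%N -> (t1 < t2)%N -> (t2 < t3)%N -> (t3 <= m)%N ->
  r t0 != r t1 -> r t1 != r t2 -> r t2 != r t3 -> False.
Proof.
elim/ltn_ind: m t0 t1 t2 t3 => m IHm t0 t1 t2 t3 mn et0 t01 t12 t23 t3m r01 r12 r23.
have rpred t : (1 < t <= m)%N -> r t = r (e t.-1).
  by case: t => // t tm; rewrite r_e //; lia.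
have ele t : (t <= m)%N -> (e t.-1 <= t0)%N.
  by move=> tm; apply: leq_trans et0; apply: e_homo; lia.
have [t0_eq0|t0_gt0] := posnP t0.
  have e0 t : (t <= m)%N -> e t.-1 = 0%N by move/ele; lia.
  by move: r23; rewrite (rpred t2) ?(rpred t3) ?e0 ?eqxx //; lia.
(* The end of the smaller window: [r p = r t0] differs from [r t3], which supplies the third
   change. *)
have [p [t0p rp rp1]] := exists_change (ltnW t01) r01.
have [t1b t2b t3b pb] : [/\ (1 < t1 <= m)%N, (1 < t2 <= m)%N, (1 < t3 <= m)%N &
    (0 < p < m)%N].
  by clear -t0_gt0 t01 t12 t23 t3m t0p; split; lia.
have r1 := rpred t1 t1b; have r2 := rpred t2 t2b; have r3 := rpred t3 t3b.
have s12 : (e t1.-1 < e t2.-1)%N.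
  rewrite ltn_neqAle e_homo ?andbT; last by clear -t12; lia.
  by apply: contraNneq r12 => s; rewrite r1 r2 s.
have s23 : (e t2.-1 < e t3.-1)%N.
  rewrite ltn_neqAle e_homo ?andbT; last by clear -t23; lia.
  by apply: contraNneq r23 => s; rewrite r2 r3 s.
have rp3 : r t3 != r p.
  by rewrite rp; move: r01 r12 r23; case: (r t0) (r t1) (r t2) (r t3) => -[] [] [].
have s3p : (e t3.-1 < p)%N.
  rewrite ltn_neqAle (leq_trans (ele t3 t3m)) ?andbT; last by case/andP: t0p.
  by apply: contraNneq rp3 => <-; rewrite r3.
have [p0 pm] := andP pb.
have pn : (0 < p <= n)%N by clear -pb mn; lia.
have ep : (e p <= e t1.-1)%N by apply: e_homo; clear -t0p; lia.
rewrite r1 r2 in r12; rewrite r2 r3 in r23; rewrite r3 in rp3.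
exact: (IHm p pm _ _ _ p pn ep s12 s23 s3p (leqnn p)).
Qed.

(** Since [r j != r n], the number of changes from [j] to [n] is odd, so two of them force a
    third. *)
Lemma window_change_uniq j m1 m2 : (0 < n)%N -> e n = j -> r j != r n ->
  (j <= m1 < n)%N -> (j <= m2 < n)%N ->
  r m1 != r m1.+1 -> r m2 != r m2.+1 -> m1 = m2.
Proof.
move=> n0 enj rjn; wlog lt12 : m1 m2 / (m1 < m2)%N => [IH|] h1 h2 c1 c2.
  case: (ltngtP m1 m2) => // lt12; first exact: IH.
  by apply/esym; apply: IH.
exfalso.
have win t1 t2 t3 : (j < t1)%N -> (t1 < t2)%N -> (t2 < t3)%N -> (t3 <= n)%N ->
    r j != r t1 -> r t1 != r t2 -> r t2 != r t3 -> False.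
  by apply: window_three_changes; rewrite ?enj; lia.
(* The cases select four points, starting with [j], at which [r] alternates. *)
have [r1|r1] := eqVneq (r m1) (r j); last first.
  have r1S : r m1.+1 = r j by move: r1 c1; case: (r j) (r m1) (r m1.+1) => -[] [].
  apply: (win m1 m1.+1 n); rewrite ?r1S 1?eq_sym //; try lia.
  by rewrite ltn_neqAle; apply/andP; split; [apply: contraNneq r1 => ->|lia].
have rj1 : r j != r m1.+1 by rewrite -r1.
have [r2|r2] := eqVneq (r m2.+1) (r j).
  apply: (win m1.+1 m2.+1 n); rewrite ?r2 // 1?[_ == r j]eq_sym //.
  - by clear -h1; lia.
  - rewrite ltn_neqAle; case/andP: h2 => _ ->; rewrite andbT.
    by apply: contraNneq rjn => <-; rewrite r2.
have r2' : r m2 = r j by move: r2 c2; case: (r j) (r m2) (r m2.+1) => -[] [].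
apply: (win m1.+1 m2 m2.+1); rewrite ?r2' // 1?[_ == r j]eq_sym //.
- by clear -h1; lia.
- by rewrite ltn_neqAle lt12 andbT; apply: contraNneq rj1 => ->; rewrite r2'.
- by case/andP: h2.
- by rewrite eq_sym.
Qed.

End Changes.

(** * Suffixes of prefixes that avoid [F] *)

Section Avoiding.
Variables (A : Type) (F : set (seq A)).
Hypothesis F_ge2 : forall u, F u -> (2 <= size u)%N.

Lemma subword_trans (u v w : seq A) : subword u v -> subword v w -> subword u w.
Proof.
move=> [p [q ->]] [p' [q' ->]]; exists (p' ++ p), (q ++ q').
by rewrite -!catA.
Qed.

Lemma avoiding_subword (u v : seq A) : subword u v -> avoiding F v -> avoiding F u.
Proof. by move=> uv Fv x Fx xu; apply: (Fv x Fx); apply: subword_trans uv. Qed.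

Lemma subword_drop i (w : seq A) : subword (drop i w) w.
Proof. by exists (take i w), [::]; rewrite cats0 cat_take_drop. Qed.

Lemma subword_take i (w : seq A) : subword (take i w) w.
Proof. by exists [::], (drop i w); rewrite cat_take_drop. Qed.

Lemma avoiding_nil : avoiding F [::].
Proof.
move=> u /F_ge2 u2 [p [q /(congr1 size)]]; rewrite !size_cat /=; lia.
Qed.

(** If no [i < m] qualifies, [find] returns [m], which is right because the empty word avoids
    [F]. *)
Definition avoiding_start (w : seq A) (m : nat) : nat :=
  find (fun i => `[< avoiding F (drop i (take m w)) >]) (iota 0 m).

Lemma avoiding_start_le w m : (avoiding_start w m <= m)%N.
Proof. by rewrite -[leqRHS](size_iota 0 m) find_size. Qed.

(** Avoidance passes to shorter suffixes, so the admissible [i] form an up-set. *)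
Lemma avoiding_drop w m i :
  `[< avoiding F (drop i (take m w)) >] = (avoiding_start w m <= i)%N.
Proof.
set s := avoiding_start w m; have sm : (s <= m)%N := avoiding_start_le w m.
have [si|] := leqP s i; last first.
  move=> si; have := @before_find _ 0%N _ _ _ si.
  by rewrite nth_iota //; lia.
apply/asboolP; apply: (@avoiding_subword _ (drop s (take m w))).
  by rewrite -(subnK si) -drop_drop; exact: subword_drop.
have [sm'|ms] := ltnP s m; last first.
  rewrite drop_oversize; first exact: avoiding_nil.
  by rewrite size_take_min; lia.
apply/asboolP; have := @nth_find _ 0%N _ _ _.
move=> /(_ (fun i => `[< avoiding F (drop i (take m w)) >]) (iota 0 m)).
rewrite -/(avoiding_start w m) -/s nth_iota // add0n; apply.
by rewrite has_find size_iota.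
Qed.

Lemma avoiding_start_homo w : {homo avoiding_start w : m p / (m <= p)%N}.
Proof.
move=> m p mp; set s := avoiding_start w p.
have [ms|sm] := leqP m s; first exact: leq_trans (avoiding_start_le w m) ms.
rewrite -avoiding_drop; apply/asboolP.
have : avoiding F (drop s (take p w)) by apply/asboolP; rewrite avoiding_drop.
apply: avoiding_subword; rewrite -(take_takel _ mp) -(subnK (ltnW sm)) -take_drop.
exact: subword_take.
Qed.

(** * Partial sums of the coefficients along the prefixes of a word *)

Definition Mcoef_psum (w : seq A) (k : nat) : int :=
  \sum_(0 <= i < k) Mcoef F (take i w).

Lemma Mcoef_psumS w k : Mcoef_psum w k.+1 = Mcoef_psum w k + Mcoef F (take k w).
Proof. by rewrite /Mcoef_psum big_nat_recr. Qed.

Lemma Mcoef_psum0 w : Mcoef_psum w 0 = 0.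
Proof. by rewrite /Mcoef_psum big_geq. Qed.

Lemma Mcoef_nil : Mcoef F [::] = 1.
Proof.
have := congr1 (fun f => wcoef f [::]) (mulVr (avoiding_series_unit F_ge2)).
rewrite [LHS]wcoef_wsmul_nil [wcoef (avoiding_series F) _]/= asboolT; last exact: avoiding_nil.
by rewrite mulr1.
Qed.

Lemma Mcoef_psum1 w : Mcoef_psum w 1 = 1.
Proof. by rewrite Mcoef_psumS Mcoef_psum0 take0 Mcoef_nil add0r. Qed.

Lemma Mcoef_psum_start w m : (0 < m <= size w)%N ->
  Mcoef_psum w m.+1 = Mcoef_psum w (avoiding_start w m).
Proof.
move=> /andP[m0 mw].
have := congr1 (fun f => wcoef f (take m w)) (mulVr (avoiding_series_unit F_ge2)).
rewrite [LHS]wcoefM size_takel // wcoef1 /nilp size_takel // eqn0Ngt m0 /=.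
rewrite -(big_mkord predT (fun i => Mcoef F (take i (take m w)) *
  (`[< avoiding F (drop i (take m w)) >])%:R)).
have sm := avoiding_start_le w m.
(* Terms below [avoiding_start w m] vanish; the others are the bare coefficients, so these add up to
   [0]. *)
rewrite /Mcoef_psum (@big_cat_nat _ _ _ (avoiding_start w m)) //=; last by lia.
rewrite big_nat big1 ?add0r => [|i /andP[_ iS]]; last first.
  by rewrite avoiding_drop leqNgt iS mulr0.
move=> sum0; rewrite (@big_cat_nat _ _ _ (avoiding_start w m)) //=; last by lia.
rewrite -[RHS]addr0; congr (_ + _); apply: etrans sum0.
apply: eq_big_nat => i /andP[si im].
by rewrite avoiding_drop si mulr1 take_takel.
Qed.

Lemma Mcoef_psum01 w k : (k <= (size w).+1)%N ->
  Mcoef_psum w k = (Mcoef_psum w k == 1)%:R.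
Proof.
elim/ltn_ind: k => -[_ _|[_ _|k IHk kw]]; rewrite ?Mcoef_psum0 ?Mcoef_psum1 //.
have := avoiding_start_le w k.+1.
by rewrite Mcoef_psum_start // => sk; apply: IHk; lia.
Qed.

Lemma subword_size (u v : seq A) : subword u v -> (size u <= size v)%N.
Proof. by move=> [p [q ->]]; rewrite !size_cat; lia. Qed.

Hypothesis F_reduced : reduced F.

(** Letters are numbered from 1, so dropping [j] of them removes just the first letter of the final
    occurrence; by reducedness what remains avoids [F]. *)
Lemma avoiding_start_suffix w j : (1 <= j <= size w)%N ->
  F (factor w j (size w)) -> avoiding_start w (size w) = j.
Proof.
rewrite /factor => jw Fj; apply/eqP; rewrite eqn_leq; apply/andP; split.
  rewrite -avoiding_drop; apply/asboolP => u Fu uj.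
  have jS : drop j (take (size w) w) = drop 1 (drop j.-1 (take (size w) w)).
    by rewrite drop_drop add1n prednK //; case/andP: jw.
  have uE : u = drop j.-1 (take (size w) w).
    apply: F_reduced => //; apply: subword_trans uj _.
    by rewrite jS; exact: subword_drop.
  have := subword_size uj; rewrite uE !size_drop take_size; lia.
rewrite -[leqLHS]prednK; last by case/andP: jw.
rewrite ltnNge -avoiding_drop; apply/negP => /asboolP /(_ _ Fj); apply.
by exists [::], [::]; rewrite cats0.
Qed.

Lemma avoiding_start_mem w : F w -> avoiding_start w (size w).-1 = 0%N.
Proof.
move=> Fw; apply/eqP; rewrite -leqn0 -avoiding_drop drop0.
apply/asboolP => u Fu uw; have /F_ge2 w2 := Fw.
have uE : u = w by apply: F_reduced => //; apply: subword_trans uw (subword_take _ _).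
have := subword_size uw; rewrite uE size_takel ?leq_pred //; lia.
Qed.

End Avoiding.

(* Without such a suffix, the last letter could be split off. *)
Lemma cluster_word_suffix (A : Type) (F : set (seq A)) (w : seq A) :
  cluster_word F w ->
  exists2 j, (1 <= j <= size w)%N & F (factor w j (size w)).
Proof.
move=> [I [mI /= w2 irr]]; apply: contrapT => noF; apply: irr.
have Ik i k : I (i, k) -> (k <= (size w).-1)%N.
  move=> Iik; have [/= i1 ik kw Fik] := mI _ _ Iik.
  have [kE|] := eqVneq k (size w); last by lia.
  by case: noF; exists i; [lia | rewrite -kE].
exists (take (size w).-1 w, I), (drop (size w).-1 w, set0); split => //=.
- move=> i k /= Iik; have [/= i1 ik kw Fik] := mI _ _ Iik.
  have km := Ik _ _ Iik; split=> //; first by rewrite size_takel ?leq_pred.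
  by rewrite /factor take_takel.
- by rewrite size_takel; lia.
- by rewrite size_drop; lia.
- by rewrite /mconcat /= cat_take_drop image_set0 setU0.
Qed.

Theorem theorem4p5 (A : Type) (F : set (seq A))
    (F_ge2 : forall u : seq A, F u -> (2 <= size u)%N)
    (F_reduced : reduced F)
    (w : seq A) (w_cluster : cluster_word F w) :
  (F w -> salient F w /\ Mcoef F w = 1) /\
  (~ F w ->
     (exists! j : nat, (1 <= j <= size w)%N /\ F (factor w j (size w))) /\
     (forall j : nat, (1 <= j <= size w)%N -> F (factor w j (size w)) ->
        (salient F w <->
           exists! m : nat, (j <= m < size w)%N /\ salient F (take m w)) /\
        (salient F w ->
           forall m : nat, (j <= m < size w)%N -> salient F (take m w) ->
             Mcoef F w = - Mcoef F (take m w)))).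
Proof.
have w2 : (2 <= size w)%N by case: w_cluster => I [].
pose R := Mcoef_psum F w; pose e := avoiding_start F w.
have MR m : Mcoef F (take m w) = R m.+1 - R m.
  by rewrite /R Mcoef_psumS addrC addKr.
have MwR : Mcoef F w = R (size w).+1 - R (size w) by rewrite -MR take_size.
have RS m : (0 < m <= size w)%N -> R m.+1 = R (e m).
  exact: Mcoef_psum_start.
have eS j : (1 <= j <= size w)%N -> F (factor w j (size w)) -> e (size w) = j.
  exact: avoiding_start_suffix.
split=> [Fw | NFw].
  have Mw : Mcoef F w = 1.
    (* The prefix of [w] without its last letter avoids [F], so the recursion leads to [R 0]. *)
    have RE : R (size w) = 0.
      rewrite -(prednK (ltnW w2)) RS; last by lia.
      by rewrite /e avoiding_start_mem // /R Mcoef_psum0.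
    have e1 : e (size w) = 1%N.
      by apply: eS; [lia | rewrite /factor drop0 take_size].
    by rewrite MwR RE subr0 RS ?e1 ?leqnn ?andbT ?(ltnW w2) // /R Mcoef_psum1.
  by split=> //; split=> //; rewrite Mw.
split.
  have [j jw Fj] := cluster_word_suffix w_cluster.
  by exists j; split=> // i [iw Fi]; rewrite -(eS j) // (eS i).
move=> j jw Fj; have ej := eS j jw Fj; have [_ jn] := andP jw.
(* Ensures that prefixes of length at least [j] meet the length condition of [salient]. *)
have j2 : (2 <= j)%N.
  rewrite ltnNge; apply/negP => j1; apply: NFw; move: Fj.
  have -> : j = 1%N by lia.
  by rewrite /factor drop0 take_size.
pose r k := R k == 1.
have Rr k : (k <= (size w).+1)%N -> R k = (r k)%:R by exact: Mcoef_psum01.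
have R_eq k l : (k <= (size w).+1)%N -> (l <= (size w).+1)%N ->
    (R k == R l) = (r k == r l).
  by move=> kw lw; rewrite !Rr //; case: (r k) (r l) => -[].
have salw : salient F w <-> r j != r (size w).
  rewrite /salient MwR RS ?ej; last by lia.
  rewrite -R_eq; [|lia|lia]; rewrite -subr_eq0.
  by split=> [[_ /eqP] // | /eqP nz]; split.
have salm m : (j <= m < size w)%N -> salient F (take m w) <-> r m != r m.+1.
  move=> jm; rewrite /salient MR size_takel; last by lia.
  rewrite [r m == _]eq_sym -R_eq; [|lia|lia]; rewrite -subr_eq0.
  by split=> [[_ /eqP] // | /eqP nz]; split=> //; lia.
have uniq_change m p : r j != r (size w) -> (j <= m < size w)%N ->
    (j <= p < size w)%N -> r m != r m.+1 -> r p != r p.+1 -> m = p.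
  apply: (@window_change_uniq r (size w) e) => //; last by lia.
  - exact: avoiding_start_homo.
  - by move=> q qw; rewrite /r RS.
split; last first.
  move=> /salw rjn m jm /(salm _ jm) cm.
  have [p [jp rp rp1]] := exists_change jn rjn.
  (* At the only change [R] passes from [R j] to [R (size w)], whereas [Mcoef F w] is
     [R j - R (size w)]: hence the sign. *)
  have pm : p = m by apply: uniq_change => //; rewrite rp rp1.
  rewrite MR MwR RS ?ej; last by lia.
  by rewrite opprB !Rr; try lia; rewrite -rp1 -rp pm.
rewrite salw; split=> [rjn | [m [[jm /(salm _ jm) cm] uniq_m]]].
  have [p [jp rp rp1]] := exists_change jn rjn.
  have cp : r p != r p.+1 by rewrite rp rp1.
  exists p; split=> [|q [jq /(salm _ jq) cq]]; first by split=> //; apply/salm.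
  exact: uniq_change.
(* A change other than the one at [m] would give a second salient prefix, so [r] is constant on each
   side of it. *)
have no_change a b : (j <= a)%N -> (a <= b)%N -> (b <= size w)%N ->
    (b <= m)%N || (m < a)%N -> r a = r b.
  move=> ja ab bw mab; case: (eqVneq (r a) (r b)) => // rab; exfalso.
  have [p [ap rp rp1]] := exists_change ab rab.
  have jp : (j <= p < size w)%N by lia.
  have /uniq_m : (j <= p < size w)%N /\ salient F (take p w).
    by split=> //; apply/salm => //; rewrite rp rp1.
  by lia.
by rewrite (no_change j m) -?(no_change m.+1 (size w)) //; lia.
Qed.
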